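(* Let $(\Omega,\mathbb F=(\mathcal F_t)_t,P)$ be a filtered probability space and let $(X_t)_{t\in\mathbb N}$ be a sequence of random variables adapted to $\mathbb F$ such that, for some $\eta>0$, $X_t\trianglelefteq_{\eta,t-1}0$ for each $t$. Let $\tau$ be an almost surely bounded stopping time with respect to $(X_t)_{t\in\mathbb N}$. Then, with $S_t=\sum_{s\le t}X_s$, $$S_\tau\trianglelefteq_\eta0.$$
   Context: For $\eta>0$, $X\trianglelefteq_\eta Y$ means $\mathbf E[e^{\eta(X-Y)}]\le1$. For a sub-$\sigma$-algebra $\mathcal H$, $X\trianglelefteq_{\eta,\mathcal H}Y$ means $\frac1\eta\log\mathbf E[e^{\eta(X-Y)}\mid\mathcal H]\le0$ almost surely, and $X_t\trianglelefteq_{\eta,t-1}0$ abbreviates $X_t\trianglelefteq_{\eta,\mathcal F_{t-1}}0$. Time is indexed by $t=1,2,\dots$, with $\mathcal F_0$ the initial $\sigma$-algebra of the filtration. *)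

(* Defs.v *)
From HB Require Import structures.
From mathcomp Require Export all_boot all_order all_algebra.
From mathcomp Require Export all_classical all_reals all_analysis.
From mathcomp Require Export measurable_realfun.

Set Implicit Arguments.
Unset Strict Implicit.
Unset Printing Implicit Defensive.

Import Order.TTheory GRing.Theory Num.Theory.

Local Open Scope classical_set_scope.
Local Open Scope ring_scope.

Definition is_sub_sigma_algebra (d : measure_display) (T : measurableType d)
    (H : set (set T)) : Prop :=
  sigma_algebra [set: T] H /\ H `<=` @measurable d T.

Definition is_filtration (d : measure_display) (T : measurableType d)
    (F : nat -> set (set T)) : Prop :=
  (forall t, is_sub_sigma_algebra (F t)) /\
  (forall s t, (s <= t)%N -> F s `<=` F t).

(* Processes are indexed by t = 1, 2, ..., while filtrations start at 0: the
   term X 0 of a process X : nat -> T -> R is junk and is never used. *)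
Definition is_adapted (d : measure_display) (T : measurableType d)
    (R : realType) (F : nat -> set (set T)) (X : nat -> T -> R) : Prop :=
  forall t, (0 < t)%N -> g_sigma_algebra_preimage (X t) `<=` F t.

(* g is a version of E[f | H], for a nonnegative random variable f.  Neither f
   nor g is assumed integrable or finite: for nonnegative functions the
   defining identity in [0, +oo] determines g up to a P-null set. *)
Definition is_cond_expectation (d : measure_display) (T : measurableType d)
    (R : realType) (P : probability T R) (H : set (set T))
    (f : T -> R) (g : T -> \bar R) : Prop :=
  [/\ g_sigma_algebra_preimage g `<=` H,
      forall w, (0 <= g w)%E &
      forall A, H A -> (\int[P]_(w in A) g w = \int[P]_(w in A) (f w)%:E)%E].

Definition esi (d : measure_display) (T : measurableType d)
    (R : realType) (P : probability T R) (eta : R) (X Y : T -> R) : Prop :=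
  ('E_P[fun w => expR (eta * (X w - Y w))] <= 1)%E.

Definition cond_esi (d : measure_display) (T : measurableType d)
    (R : realType) (P : probability T R) (eta : R) (H : set (set T))
    (X Y : T -> R) : Prop :=
  exists2 g : T -> \bar R,
    is_cond_expectation P H (fun w => expR (eta * (X w - Y w))) g &
    {ae P, forall w, ((eta^-1)%:E * lne (g w) <= 0)%E}.

(* A random time takes values in the naturals extended with +oo, which is
   encoded as None. *)
Definition time_le (tau : option nat) (t : nat) : bool :=
  if tau is Some n then (n <= t)%N else false.

Definition is_stopping_time (d : measure_display) (T : measurableType d)
    (F : nat -> set (set T)) (tau : T -> option nat) : Prop :=
  forall t, F t [set w | time_le (tau w) t].

Definition as_bounded (d : measure_display) (T : measurableType d)
    (R : realType) (P : probability T R) (tau : T -> option nat) : Prop :=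
  exists N : nat, {ae P, forall w, time_le (tau w) N}.

Definition partial_sum (T : Type) (R : realType) (X : nat -> T -> R)
    (t : nat) (w : T) : R :=
  \sum_(1 <= s < t.+1) X s w.

(* The value 0 on the event that tau is infinite is a convention; this event is
   null when tau is almost surely bounded. *)
Definition stopped_sum (T : Type) (R : realType) (X : nat -> T -> R)
    (tau : T -> option nat) (w : T) : R :=
  if tau w is Some t then partial_sum X t w else 0.

(* Stopping times with respect to the process X itself are the stopping times of
   its natural filtration; for an adapted process they are stopping times of the
   ambient filtration. *)
Definition natural_filtration (d : measure_display) (T : measurableType d)
    (R : realType) (X : nat -> T -> R) (t : nat) : set (set T) :=
  <<s \bigcup_(s in [set s | (0 < s <= t)%N]) g_sigma_algebra_preimage (X s) >>.

Lemma natural_stopping_time (d : measure_display) (T : measurableType d)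
    (R : realType) (F : nat -> set (set T)) (X : nat -> T -> R)
    (tau : T -> option nat) :
  is_filtration F -> is_adapted F X ->
  is_stopping_time (natural_filtration X) tau -> is_stopping_time F tau.
Proof.
move=> [subF incF] adX tauX t; have := tauX t; apply: smallest_sub => //.
  by have [] := subF t.
by apply: bigcup_sub => s /= /andP[s0 st] A /(adX _ s0); exact: incF.
Qed.

(* Main.v *)
(* With Z_s = X_s on {tau >= s} and Z_s = 0 on {tau < s}, the process
   M_n = exp(eta * (Z_1 + ... + Z_n)) is a supermartingale: M_n is
   F_n-measurable, {tau >= n + 1} belongs to F_n, and the conditional ESI bounds
   E[exp(eta * Z_(n+1)) | F_n] by 1.  Hence E[M_N] <= E[M_0] = 1, and M_N is
   almost surely exp(eta * S_tau) as soon as tau <= N almost surely.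
   Integrability is never needed: conditional bounds are used as inequalities
   between integrals over F_n-sets, extended to nonnegative F_n-measurable
   weights by simple functions and monotone convergence. *)
Require Import Defs.
From mathcomp Require Import finmap.

Set Implicit Arguments.
Unset Strict Implicit.
Unset Printing Implicit Defensive.

Import Order.TTheory GRing.Theory Num.Theory.
Local Open Scope classical_set_scope.
Local Open Scope ring_scope.

(** * Measurability with respect to a sub-sigma-algebra *)

Section sub_sigma_algebra.
Context {d : measure_display} {T : measurableType d}.
Variables (H : set (set T)) (subH : is_sub_sigma_algebra H).

(** Generating from [H] adds nothing, since [H] is already a sigma-algebra. Closure properties of
    [measurable] thereby become available for the sets of [H]. *)
Lemma measurable_sub_sigma_algebra (A : set (g_sigma_algebraType H)) :
  measurable A <-> H A.
Proof. by case: subH => sigmaH _; rewrite /measurable/= sigma_algebra_id. Qed.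

Lemma measurable_fun_sub_sigma_algebra d' (T' : measurableType d')
    (f : T -> T') :
  measurable_fun [set: g_sigma_algebraType H] (f : g_sigma_algebraType H -> T') ->
  measurable_fun [set: T] f.
Proof.
move=> mf _ B mB; case: (subH) => _; apply.
by apply/measurable_sub_sigma_algebra; exact: mf.
Qed.

Lemma measurable_fun_preimage_sub d' (T' : measurableType d') (f : T -> T') :
  g_sigma_algebra_preimage f `<=` H ->
  measurable_fun [set: g_sigma_algebraType H] (f : g_sigma_algebraType H -> T').
Proof.
by move=> fH _ B mB; apply/measurable_sub_sigma_algebra/fH; exists B.
Qed.

End sub_sigma_algebra.

(** * Integral inequalities over sets of a sub-sigma-algebra *)

Section weighted_integral.
Context {d : measure_display} {T : measurableType d} {R : realType}.
Variables (mu : {measure set T -> \bar R}) (H : set (set T)).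
Hypothesis subH : is_sub_sigma_algebra H.
Import HBNNSimple.
Local Open Scope ereal_scope.

Let mH (A : set T) : H A -> measurable A.
Proof. by case: subH => _; apply. Qed.

(** The weight [u] is a finite combination of indicators of its level sets, and these belong to [H]:
    only integrals of [f] over [H]-sets remain. *)
Lemma ge0_integral_nnsfunM (u : {nnsfun (g_sigma_algebraType H) >-> R})
    (f : T -> R) (s := fset_set (range u)) :
  measurable_fun setT f -> (forall x, (0 <= f x)%R) ->
  \int[mu]_x (u x * f x)%:E =
  \sum_(i < #|`s|) (s`_i)%:E * \int[mu]_(x in u @^-1` [set s`_i]) (f x)%:E.
Proof.
move=> mf f0.
have s0 (i : 'I_#|`s|) : (0 <= s`_i)%R.
  have : s`_i \in s by apply: mem_nth.
  by rewrite in_fset_set// => /set_mem[x _ <-].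
have mA (i : 'I_#|`s|) : measurable (u @^-1` [set s`_i] : set T).
  apply/mH/(measurable_sub_sigma_algebra subH).
  by rewrite -[X in measurable X]setTI; exact: measurable_funP.
have mfA (i : 'I_#|`s|) :
    measurable_fun setT ((EFin \o f) \_ (u @^-1` [set s`_i] : set T)).
  apply/(measurable_restrictT _ (mA i)).
  by apply/measurable_EFinP; exact: measurable_funTS.
have fA0 (i : 'I_#|`s|) x :
    0 <= ((EFin \o f) \_ (u @^-1` [set s`_i] : set T)) x.
  by apply: erestrict_ge0 => y _; rewrite lee_fin.
transitivity (\int[mu]_x \sum_(i < #|`s|)
    ((s`_i)%:E * ((EFin \o f) \_ (u @^-1` [set s`_i])) x)).
  apply: eq_integral => x _; rewrite fimfunEord mulr_suml -sumEFin.
  apply: eq_bigr => i _; rewrite patchE indicE.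
  case: ifPn => _; first by rewrite mulr1 EFinM.
  by rewrite mulr0 mul0r mule0.
rewrite ge0_integral_sum//.
- apply: eq_bigr => i _; rewrite ge0_integralZl//; last by rewrite lee_fin.
  by rewrite -integral_mkcond.
- by move=> i; exact: measurable_funeM.
- by move=> i x _; rewrite mule_ge0// lee_fin.
Qed.

Lemma ge0_le_integral_mulr (f g h : T -> R) :
  measurable_fun setT f -> (forall x, (0 <= f x)%R) ->
  measurable_fun setT g -> (forall x, (0 <= g x)%R) ->
  (forall A, H A ->
    \int[mu]_(x in A) (f x)%:E <= \int[mu]_(x in A) (g x)%:E) ->
  measurable_fun setT (h : g_sigma_algebraType H -> R) ->
  (forall x, (0 <= h x)%R) ->
  \int[mu]_x (h x * f x)%:E <= \int[mu]_x (h x * g x)%:E.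
Proof.
move=> mf f0 mg g0 fg mh h0.
have mEh : measurable_fun setT (EFin \o (h : g_sigma_algebraType H -> R)).
  exact/measurable_EFinP.
(* The approximation takes place on [g_sigma_algebraType H], so that the level sets of every [u n]
   lie in [H], where the hypothesis compares [f] with [g]. *)
pose u := nnsfun_approx measurableT mEh.
have mu_ n : measurable_fun setT (u n : T -> R).
  apply: (measurable_fun_sub_sigma_algebra subH).
  exact: measurable_funP.
have ndu x m n : (m <= n)%N -> (u m x <= u n x)%R.
  by move=> mn; exact/lefP/nd_nnsfun_approx.
have cvgu (k : T -> R) : measurable_fun setT k -> (forall x, (0 <= k x)%R) ->
    \int[mu]_x (u n x * k x)%:E @[n --> \oo] --> \int[mu]_x (h x * k x)%:E.
  move=> mk k0.
  rewrite (_ : \int[mu]_x (h x * k x)%:E =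
               \int[mu]_x limn (fun n => (u n x * k x)%:E)); last first.
    apply: eq_integral => x _; apply/esym/cvg_lim => //.
    rewrite EFinM; under eq_fun do rewrite EFinM.
    apply: cvgeZr => //.
    by apply: (cvg_nnsfun_approx measurableT mEh) => // y _; rewrite lee_fin.
  apply: cvg_monotone_convergence => //.
  - by move=> n; apply/measurable_EFinP; exact: measurable_funM.
  - by move=> n x _; rewrite lee_fin mulr_ge0.
  - by move=> x _ m n mn; rewrite lee_fin ler_wpM2r// ndu.
have cf := cvgu _ mf f0; have cg := cvgu _ mg g0.
rewrite -(cvg_lim _ cf)// -(cvg_lim _ cg)//; apply: lee_lim.
- by apply/cvg_ex; eexists; exact: cf.
- by apply/cvg_ex; eexists; exact: cg.
(* For a simple weight the two sums have the same nonnegative coefficients and are compared term by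
   term. *)
apply: nearW => n; rewrite !ge0_integral_nnsfunM//.
apply: lee_sum => i _; apply: lee_wpmul2l.
  have : (fset_set (range (u n)))`_i \in fset_set (range (u n)).
    exact: mem_nth.
  by rewrite in_fset_set// => /set_mem[x _ <-]; rewrite lee_fin.
apply/fg/(measurable_sub_sigma_algebra subH).
by rewrite -[X in measurable X]setTI; exact: measurable_funP.
Qed.

End weighted_integral.

(** The conditional expectation [g] has the same integral over [A] as the exponential, and since
    [eta] is positive, a nonpositive scaled logarithm means that [g] is at most 1 almost surely. *)
Lemma cond_esi_le_integral (d : measure_display) (T : measurableType d)
    (R : realType) (P : probability T R) (eta : R) (H : set (set T))
    (X Y : T -> R) (A : set T) :
  0 < eta -> is_sub_sigma_algebra H -> cond_esi P eta H X Y -> H A ->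
  (\int[P]_(w in A) (expR (eta * (X w - Y w)))%:E <= \int[P]_(w in A) 1)%E.
Proof.
move=> eta0 subH [g [gH g0 gint] gle] HA; rewrite -gint//.
have mA : measurable A by case: subH => _; apply.
have mg : measurable_fun setT g.
  apply: (measurable_fun_sub_sigma_algebra subH).
  exact: measurable_fun_preimage_sub.
apply: ae_ge0_le_integral => //; first exact: measurable_funTS.
apply: filterS gle => w + _.
by rewrite pmule_rle0 ?lte_fin ?invr_gt0// lne_le0.
Qed.

(** * Measurability of the stopped sum *)

Lemma measurable_stopping_time (d : measure_display) (T : measurableType d)
    (F : nat -> set (set T)) (tau : T -> option nat) (t : nat) :
  is_filtration F -> is_stopping_time F tau ->
  measurable [set w | tau w = Some t].
Proof.
move=> [subF _] tauF.
have mle s : measurable [set w | time_le (tau w) s].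
  by case: (subF s) => _; apply; exact: tauF.
case: t => [|t].
  rewrite (_ : [set _ | _] = [set w | time_le (tau w) 0])//.
  apply/seteqP; split=> w /=; first by move=> ->.
  by case: (tau w) => //= n; rewrite leqn0 => /eqP ->.
rewrite (_ : [set _ | _] =
  [set w | time_le (tau w) t.+1] `\` [set w | time_le (tau w) t]); last first.
  apply/seteqP; split=> w /=; first by move=> -> /=; rewrite ltnn.
  case: (tau w) => [n|[]//] /= [nt /negP]; rewrite -ltnNge => tn.
  by congr Some; apply/eqP; rewrite eqn_leq nt.
exact: measurableD.
Qed.

Lemma measurable_stopped_sum (d : measure_display) (T : measurableType d)
    (R : realType) (F : nat -> set (set T)) (X : nat -> T -> R)
    (tau : T -> option nat) :
  is_filtration F -> is_stopping_time F tau ->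
  (forall t, measurable_fun setT (X t)) ->
  measurable_fun setT (stopped_sum X tau).
Proof.
move=> filF tauF mX.
pose E n := [set w | tau w = Some n].
have mE n : measurable (E n) by exact: measurable_stopping_time tauF.
have mUE : measurable (\bigcup_n E n) by exact: bigcupT_measurable.
(* The events [E n] and the event that [tau] is infinite cover the space; the stopped sum is a fixed
   partial sum on each [E n] and 0 on the remaining event. *)
rewrite -(setvU (\bigcup_n E n)); apply/measurable_funU => //.
  exact: measurableC.
split.
  apply: (eq_measurable_fun (cst 0 : T -> R)) => [w /set_mem Ew|]; last first.
    exact: measurable_cst.
  rewrite /stopped_sum; case tw: (tau w) => [n|//].
  by exfalso; apply: Ew; exists n.
apply/measurable_fun_bigcup => // n.
apply: (eq_measurable_fun (partial_sum X n)) => [w /set_mem Ew|].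
  by rewrite /stopped_sum Ew.
by apply: measurable_funTS; exact: measurable_sum.
Qed.

(** * Increments cancelled after the stopping time *)

(** For positive [s], the event that [tau] is at least [s] is expressed as the failure of [tau]
    being at most [s.-1], which makes it an event of [F s.-1]: whether the next increment counts is
    known one step ahead. *)
Definition stopped_increment (T : Type) (R : realType) (X : nat -> T -> R)
    (tau : T -> option nat) (s : nat) (w : T) : R :=
  if time_le (tau w) s.-1 then 0 else X s w.

Lemma stopped_sumE (T : Type) (R : realType) (X : nat -> T -> R)
    (tau : T -> option nat) (n : nat) (w : T) : time_le (tau w) n ->
  stopped_sum X tau w = partial_sum (stopped_increment X tau) n w.
Proof.
rewrite /stopped_sum /partial_sum /stopped_increment.
case: (tau w) => //= t tn.
(* Cut at the value [t] of [tau]: the increments up to [t] are those of [X], the later ones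
   vanish. *)
rewrite [RHS](big_cat_nat (n := t.+1))//= [X in _ + X]big1_seq ?addr0.
  apply: eq_big_nat => -[//|s] /andP[_]; rewrite ltnS => st.
  by rewrite /= leqNgt st.
move=> s; rewrite mem_index_iota => /andP[_ /andP[ts _]].
by rewrite -ltnS (ltn_predK ts) ts.
Qed.

Lemma measurable_stopped_increment (d : measure_display)
    (T : measurableType d) (R : realType) (F : nat -> set (set T))
    (X : nat -> T -> R) (tau : T -> option nat) (n : nat) :
  is_filtration F -> is_adapted F X -> is_stopping_time F tau ->
  measurable_fun setT
    (stopped_increment X tau n.+1 : g_sigma_algebraType (F n.+1) -> R).
Proof.
move=> [subF incF] adX tauF; apply: measurable_fun_if => //.
- apply: (measurable_fun_bool true); rewrite setTI.
  apply/(measurable_sub_sigma_algebra (subF n.+1)).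
  exact: (incF n) (leqnSn n) _ (tauF n).
- apply: measurable_funTS; apply: (measurable_fun_preimage_sub (subF n.+1)).
  exact: adX.
Qed.

Lemma measurable_stopped_partial_sum (d : measure_display)
    (T : measurableType d) (R : realType) (F : nat -> set (set T))
    (X : nat -> T -> R) (tau : T -> option nat) (n : nat) :
  is_filtration F -> is_adapted F X -> is_stopping_time F tau ->
  measurable_fun setT
    (partial_sum (stopped_increment X tau) n : g_sigma_algebraType (F n) -> R).
Proof.
move=> [subF incF] adX tauF.
rewrite (_ : partial_sum _ _ =
    fun w => \sum_(i < n) stopped_increment X tau i.+1 w); last first.
  by apply/funext => w; rewrite /partial_sum big_add1 big_mkord.
apply: measurable_sum => i _ B mB.
apply/(measurable_sub_sigma_algebra (subF n)); apply: (incF i.+1) => //.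
apply/(measurable_sub_sigma_algebra (subF i.+1)).
have filF : is_filtration F by split.
have mZ := measurable_stopped_increment (n := i) filF adX tauF.
exact: (mZ measurableT B mB).
Qed.

(** Split [A] along the event that [tau] is at most [n]. Both pieces are in [F n]; on the first the
    increment is 0 and the exponential is 1, on the second the increment is [X n.+1] and the
    conditional ESI applies. *)
Lemma stopped_increment_le_integral (d : measure_display)
    (T : measurableType d) (R : realType) (P : probability T R)
    (F : nat -> set (set T)) (X : nat -> T -> R) (eta : R)
    (tau : T -> option nat) (n : nat) (A : set T) :
  0 < eta -> is_filtration F -> is_stopping_time F tau ->
  measurable_fun setT (stopped_increment X tau n.+1) ->
  cond_esi P eta (F n) (X n.+1) (cst 0) ->
  F n A ->
  (\int[P]_(w in A) (expR (eta * stopped_increment X tau n.+1 w))%:E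
    <= \int[P]_(w in A) 1)%E.
Proof.
move=> eta0 [subF _] tauF mZ esiX FA.
pose B := [set w | time_le (tau w) n].
have FAB : F n (A `&` B).
  by apply/(measurable_sub_sigma_algebra (subF n))/measurableI;
    apply/(measurable_sub_sigma_algebra (subF n)) => //; exact: tauF.
have FAC : F n (A `\` B).
  by apply/(measurable_sub_sigma_algebra (subF n))/measurableD;
    apply/(measurable_sub_sigma_algebra (subF n)) => //; exact: tauF.
have mF C : F n C -> measurable C by case: (subF n) => _; apply.
have AB : [disjoint A `&` B & A `\` B].
  by apply/disj_setPS => w [[_ Bw] [_]].
have mAB := mF _ FAB; have mAC := mF _ FAC.
have mexpZ : measurable_fun (A `&` B `|` A `\` B)
    (fun w => (expR (eta * stopped_increment X tau n.+1 w))%:E).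
  apply: measurable_funTS; apply/measurable_EFinP; apply: measurableT_comp => //.
  exact: measurable_funM.
rewrite -(setUIDK A B) ge0_integral_setU//.
rewrite [leRHS]ge0_integral_setU//.
apply: leeD.
  rewrite le_eqVlt; apply/predU1P; left; apply: eq_integral => w.
  by move=> /set_mem[_ Bw]; rewrite /stopped_increment/= Bw mulr0 expR0.
apply: le_trans (cond_esi_le_integral eta0 (subF n) esiX FAC).
rewrite le_eqVlt; apply/predU1P; left; apply: eq_integral => w.
by move=> /set_mem[_ /negP/negbTE Bw]; rewrite /stopped_increment/= Bw subr0.
Qed.

(** * The supermartingale bound and its transfer to the stopped sum *)

Theorem proposition34 (d : measure_display) (T : measurableType d)
    (R : realType) (P : probability T R)
    (F : nat -> set (set T)) (hF : is_filtration F)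
    (X : nat -> {RV P >-> R}) (hX : is_adapted F X)
    (eta : R) (eta_gt0 : 0 < eta)
    (hesi : forall t : nat, (0 < t)%N -> cond_esi P eta (F t.-1) (X t) (cst 0))
    (tau : T -> option nat)
    (htau : is_stopping_time F tau) (hbound : as_bounded P tau) :
  esi P eta (stopped_sum X tau) (cst 0).
Proof.
pose Z := stopped_increment X tau.
pose M n w := expR (eta * partial_sum Z n w).
have mX t : measurable_fun setT (X t) by exact: measurable_funP.
have [subF _] := hF.
have mMF n : measurable_fun setT (M n : g_sigma_algebraType (F n) -> R).
  apply: measurableT_comp => //; apply: measurable_funM => //.
  exact: measurable_stopped_partial_sum.
have mM n : measurable_fun setT (M n).
  exact: (measurable_fun_sub_sigma_algebra (subF n)).
have mZ n : measurable_fun setT (Z n.+1).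
  apply: (measurable_fun_sub_sigma_algebra (subF n.+1)).
  exact: measurable_stopped_increment.
have EM n : (\int[P]_w (M n w)%:E <= 1)%E.
  elim: n => [|n IH].
    rewrite (eq_integral (cst 1%E)) ?integral_cst//= ?mul1e ?probability_setT//.
    by move=> w _; rewrite /M /partial_sum big_geq// mulr0 expR0.
  apply: le_trans IH.
  (* [M n.+1] is the [F n]-measurable weight [M n] times the exponential of the new increment;
     writing [M n] as [M n] times 1 turns the step into a weighted comparison of that exponential
     with 1. *)
  rewrite (eq_integral (fun w => (M n w * expR (eta * Z n.+1 w))%:E)); last first.
    by move=> w _; rewrite /M /partial_sum big_nat_recr//= mulrDr expRD.
  rewrite -[leRHS](eq_integral _ (fun w => (M n w * 1)%:E)); last first.
    by move=> w _; rewrite mulr1.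
  apply: (ge0_le_integral_mulr (subF n)) => //.
  - by apply: measurableT_comp => //; exact: measurable_funM.
  - move=> A FA.
    exact: (stopped_increment_le_integral eta_gt0 hF htau _ (hesi n.+1 isT)).
  - by move=> w; exact: expR_ge0.
have [N tauN] := hbound.
rewrite /esi unlock; apply: le_trans (EM N).
(* The two exponentials agree wherever [tau] is at most [N], hence almost surely. *)
rewrite le_eqVlt; apply/predU1P; left; apply: ge0_ae_eq_integral => //.
- apply/measurable_EFinP; apply: measurableT_comp => //.
  apply: measurable_funM => //; apply: measurable_funB => //.
  exact: measurable_stopped_sum htau _.
- exact/measurable_EFinP.
- by move=> w _; rewrite lee_fin expR_ge0.
- by apply: filterS tauN => w tw _; rewrite /= subr0 (stopped_sumE _ tw).
Qed.
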